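(* Let $0<q,t<1$ and $m\ge1$. Started from any initial configuration in $\mathbb{W}_m$, the discrete time Markov chain on $\mathbb{W}_m$ with transition probabilities $\Upsilon_m(\vec{\mathsf{x}},\vec{\mathsf{y}})$ reaches, with probability $1$, the state $\delta_m=(m-1,m-2,\dots,1,0)$, and this state is absorbing.
   Context: $\mathbb{W}_m$ is the set of integer vectors $\vec{\mathsf{x}}=(\mathsf{x}_1>\dots>\mathsf{x}_m\ge0)$. For $|p|<1$, $(z;p)_\infty=\prod_{i\ge 0}(1-zp^i)$, and $$V_{t,q}(\vec{\mathsf{x}})=\prod_{1\le i<j\le m}\frac{\left(q^{j-i-1}t^{\mathsf{x}_i-\mathsf{x}_j-j+i+1};t\right)_\infty}{\left(q^{j-i}t^{\mathsf{x}_i-\mathsf{x}_j-j+i+1};t\right)_\infty}.$$ For $\vec{\mathsf{x}},\vec{\mathsf{y}}\in\mathbb{W}_m$ with $\mathsf{y}_i-\mathsf{x}_i\in\{-1,0\}$ for all $i$, $$\Upsilon_m(\vec{\mathsf{x}},\vec{\mathsf{y}})=t^{-\binom m2}\,\frac{V_{t,q}(\vec{\mathsf{y}})}{V_{t,q}(\vec{\mathsf{x}})}\prod_{\substack{1\le i<j\le m\\ \mathsf{y}_i=\mathsf{x}_i,\ \mathsf{y}_j=\mathsf{x}_j-1}}\frac{(1-t^{i-j+\mathsf{x}_i-\mathsf{x}_j+1}q^{j-i-1})(1-t^{i-j+\mathsf{x}_i-\mathsf{x}_j}q^{j-i+1})}{(1-t^{i-j+\mathsf{x}_i-\mathsf{x}_j+1}q^{j-i})(1-t^{i-j+\mathsf{x}_i-\mathsf{x}_j}q^{j-i})}\prod_{i:\,\mathsf{y}_i=\mathsf{x}_i}t^{\mathsf{x}_i}\prod_{i:\,\mathsf{y}_i=\mathsf{x}_i-1}\left(t^{m-i}-q^{m-i}t^{\mathsf{x}_i}\right),$$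 and $\Upsilon_m(\vec{\mathsf{x}},\vec{\mathsf{y}})=0$ for all other $\vec{\mathsf{y}}\in\mathbb{W}_m$. These quantities are nonnegative and satisfy $\sum_{\vec{\mathsf{y}}\in\mathbb{W}_m}\Upsilon_m(\vec{\mathsf{x}},\vec{\mathsf{y}})=1$, so they define a Markov chain on $\mathbb{W}_m$. *)

(* Defs.v *)
From HB Require Import structures.
From mathcomp Require Import all_boot all_order all_algebra.
From mathcomp Require Import all_classical all_reals all_analysis.

Set Implicit Arguments.
Unset Strict Implicit.
Unset Printing Implicit Defensive.

Import Order.TTheory GRing.Theory Num.Theory.
Import numFieldNormedType.Exports.

Local Open Scope classical_set_scope.
Local Open Scope ring_scope.

(* Coordinates are indexed from 0: the paper's x_i (1 <= i <= m) is the
   coordinate i-1 here. Differences of indices are unaffected, while the paper's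
   m - i becomes m - i.+1. *)
Definition in_weyl (m : nat) (x : {ffun 'I_m -> int}) : bool :=
  [forall i, 0 <= x i] && [forall i : 'I_m, forall j : 'I_m, (i < j)%N ==> (x j < x i)].

Record weyl (m : nat) := Weyl {
  weyl_val :> {ffun 'I_m -> int} ;
  _ : in_weyl weyl_val }.

HB.instance Definition _ (m : nat) := [isSub for @weyl_val m].
HB.instance Definition _ (m : nat) := [Countable of weyl m by <:].

Definition delta_val (m : nat) : {ffun 'I_m -> int} :=
  [ffun i : 'I_m => (m - i.+1)%:Z].

Lemma delta_in_weyl (m : nat) : in_weyl (delta_val m).
Proof.
apply/andP; split; first by apply/forallP => i; rewrite ffunE.
apply/forallP => i; apply/forallP => j; apply/implyP => ij.
by rewrite !ffunE ltz_nat ltn_sub2l // (leq_ltn_trans _ (ltn_ord j)).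
Qed.

Definition delta (m : nat) : weyl m := Weyl (delta_in_weyl m).

Section Upsilon.
Context {R : realType}.

Definition qpoch_inf (z p : R) : R :=
  limn (fun n : nat => \prod_(0 <= i < n) (1 - z * p ^+ i)).

Definition Vtq (q t : R) (m : nat) (x : weyl m) : R :=
  \prod_(i < m) \prod_(j < m | (i < j)%N)
    (qpoch_inf (q ^+ (j - i - 1) * t ^ (x i - x j - j%:Z + i%:Z + 1)) t /
     qpoch_inf (q ^+ (j - i) * t ^ (x i - x j - j%:Z + i%:Z + 1)) t).

Definition Upsilon (q t : R) (m : nat) (x y : weyl m) : R :=
  if [forall i, (y i == x i) || (y i == x i - 1)] then
    t ^- 'C(m, 2) * (Vtq q t y / Vtq q t x) *
    (\prod_(i < m) \prod_(j < m | [&& (i < j)%N, y i == x i & y j == x j - 1])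
       (((1 - t ^ (i%:Z - j%:Z + x i - x j + 1) * q ^+ (j - i - 1)) *
         (1 - t ^ (i%:Z - j%:Z + x i - x j) * q ^+ (j - i + 1))) /
        ((1 - t ^ (i%:Z - j%:Z + x i - x j + 1) * q ^+ (j - i)) *
         (1 - t ^ (i%:Z - j%:Z + x i - x j) * q ^+ (j - i))))) *
    (\prod_(i < m | y i == x i) t ^ x i) *
    (\prod_(i < m | y i == x i - 1)
       (t ^+ (m - i.+1) - q ^+ (m - i.+1) * t ^ x i))
  else 0.

End Upsilon.

Section MarkovChain.
Context {R : realType} {d : measure_display} {Om : measurableType d}.
Variable P : probability Om R.

Definition cond_prob (A B : set Om) : R := fine (P (A `&` B)) / fine (P B).

(* Time-homogeneous Markov chain with countable state space S, started at s0,
   with transition probabilities K; S carries its discrete sigma-algebra. *)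
Definition markov_chain (S : countType) (K : S -> S -> R) (s0 : S)
    (X : nat -> Om -> S) : Prop :=
  [/\ forall (n : nat) (A : set S), measurable (X n @^-1` A),
      P [set w | X 0%N w = s0] = 1%E
    & forall (n : nat) (h : nat -> S) (s : S),
        let history := [set w | forall k : nat, (k <= n)%N -> X k w = h k] in
        (0 < P history)%E ->
        cond_prob [set w | X n.+1 w = s] history = K (h n) s].

End MarkovChain.

Definition absorbing (R : realType) (S : countType) (K : S -> S -> R) (s : S)
  : Prop := K s s = 1.

(* Main.v *)
Require Import Defs.
From mathcomp Require Import all_boot all_order all_algebra.
From mathcomp Require Import all_classical all_reals all_analysis.
From mathcomp Require Import zify.

Set Implicit Arguments.
Unset Strict Implicit.
Unset Printing Implicit Defensive.

Import Order.TTheory GRing.Theory Num.Theory.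
Import numFieldNormedType.Exports.

Local Open Scope classical_set_scope.
Local Open Scope ring_scope.

(** The walk moves every coordinate down or not at all, so it stays in place or
    loses some of its excess over delta, the sum over i of x_i - (m - i) in
    one-based indexing.  The excess is a natural number, since the coordinates
    decrease strictly to a last coordinate that is at least 0, and it vanishes
    only at delta.  When y = x, no index moves, the two values of V cancel, and
    what remains of Upsilon x x is t to the power excess x ([Upsilon_diag]).
    Thus the holding probability is 1 at delta and lies strictly between 0 and 1
    at every other state.

    The rest is a general fact about chains on a countable state space
    ([ranked_chain_hits]).  Almost surely every transition made has a nonzero
    kernel value, so along a path a natural number decreases at each move and the
    path is eventually constant.  Holding at a fixed s with holding probability
    k < 1 for n more steps costs a factor k ^ n, so being eventually constant at
    s along a given initial segment is a null event, and there are countably many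
    such segments.  Hence the path can only become constant at delta.

    The cancellation of V needs V to be nonzero.  The Weyl inequalities
    x_i - x_j >= j - i put the argument of every Pochhammer symbol in the open
    interval from 0 to 1, where the infinite product is positive
    ([qpoch_inf_gt0]). *)

(** * Paths of a Markov chain on a countable state space *)

Lemma negligible_bigcup_countType d (T : sigmaRingType d) (R : realFieldType)
    (mu : {measure set T -> \bar R}) (I : countType) (F : I -> set T) :
  (forall i, mu.-negligible (F i)) -> mu.-negligible (\bigcup_i F i).
Proof.
move=> F0; pose G n := if unpickle n is Some i then F i else set0.
apply: (@negligibleS _ _ _ _ (\bigcup_n G n)) => [w [i _ Fw]|].
  by exists (pickle i) => //; rewrite /G pickleK.
apply: negligible_bigcup => n; rewrite /G.
by case: unpickle => [i|]; [exact: F0 | exact: negligible_set0].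
Qed.

(** From a time at which the rank of the path is minimal no move is possible. *)
Lemma stationary_of_rank (S : Type) (r : S -> nat) (f : nat -> S) :
  (forall n, f n.+1 = f n \/ (r (f n.+1) < r (f n))%N) ->
  exists n, forall k, (n <= k)%N -> f k = f n.
Proof.
move=> step; pose A := fun v => `[< exists n, r (f n) = v >].
have exA : exists v, A v by exists (r (f 0%N)); apply/asboolP; exists 0%N.
have [_ /asboolP[n <-] rmin] := ex_minnP exA.
exists n; elim=> [|k IH]; first by case: n {rmin}.
rewrite leq_eqVlt => /orP[/eqP <- //|/IH fk].
have [|] := step k; rewrite fk // ltnNge => /negP[].
by apply: rmin; apply/asboolP; exists k.+1.
Qed.

Section MarkovPaths.
Context (R : realType) (d : measure_display) (Om : measurableType d).
Variables (P : probability Om R) (S : countType) (K : S -> S -> R) (s0 : S).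
Variable X : nat -> Om -> S.
Hypothesis chainX : markov_chain P K s0 X.

Definition history (n : nat) (h : nat -> S) : set Om :=
  [set w | forall k : nat, (k <= n)%N -> X k w = h k].

Lemma historyS n h :
  history n.+1 h = [set w | X n.+1 w = h n.+1] `&` history n h.
Proof.
apply/seteqP; split=> w /=.
  by move=> Hw; split=> [|k kn]; apply: Hw => //; exact: leqW.
by move=> [Xn Hw] k; rewrite leq_eqVlt => /orP[/eqP -> //|/Hw].
Qed.

Lemma measurable_state n (s : S) : measurable [set w | X n w = s].
Proof. by have [mX _ _] := chainX; exact: (mX n [set s]). Qed.

Lemma measurable_history n h : measurable (history n h).
Proof.
elim: n => [|n IH]; last first.
  by rewrite historyS; apply: measurableI => //; exact: measurable_state.
rewrite [history _ _](_ : _ = [set w | X 0%N w = h 0%N]).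
  exact: measurable_state.
apply/seteqP; split=> w /=; first exact.
by move=> Xw k; rewrite leqn0 => /eqP ->.
Qed.

(** The Markov property without its positivity condition: from a null history
    both sides vanish. *)
Lemma history_step n h :
  fine (P (history n.+1 h)) = fine (P (history n h)) * K (h n) (h n.+1).
Proof.
have [_ _ markov] := chainX.
have [P0|Ppos] := eqVneq (P (history n h)) 0%E.
  rewrite P0 mul0r (_ : P (history n.+1 h) = 0%E) //.
  apply/eqP; rewrite -measure_le0 -P0; apply: le_measure.
  - by rewrite inE; exact: measurable_history.
  - by rewrite inE; exact: measurable_history.
  - by rewrite historyS; exact: subIsetr.
have {}Ppos : (0 < P (history n h))%E by rewrite lt0e Ppos measure_ge0.
have <- := markov n h (h n.+1) Ppos.
rewrite /cond_prob -historyS mulrC divfK // gt_eqF // fine_gt0 // Ppos /=.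
by rewrite ltey_eq fin_num_measure //; exact: measurable_history.
Qed.

(** The function [nth s l] is the path that follows [l] and stays at [s] from
    time [size l] on; these paths form a countable family. *)
Lemma history_stay l (s : S) n :
  fine (P (history (size l + n) (nth s l))) =
  fine (P (history (size l) (nth s l))) * K s s ^+ n.
Proof.
elim: n => [|n IH]; first by rewrite addn0 mulr1.
by rewrite addnS history_step IH !nth_default -?addnS ?leq_addr // exprSr mulrA.
Qed.

(** A transition with zero kernel value ends a null history by [history_step], and
    there are only countably many histories. *)
Lemma negligible_zero_transition :
  P.-negligible [set w | exists n, K (X n w) (X n.+1 w) = 0].
Proof.
pose F (i : nat * S * seq S) := let: (n, s, l) := i in
  if K (nth s l n) (nth s l n.+1) == 0 then history n.+1 (nth s l) else set0.
apply: (@negligibleS _ _ _ _ (\bigcup_i F i)).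
  move=> w [n Kn]; pose l := mkseq (X^~ w) n.+2.
  (* [s0] is only a default value: [l] covers all times up to [n.+1]. *)
  have lE k : (k <= n.+1)%N -> nth s0 l k = X k w by move=> ?; rewrite nth_mkseq.
  exists (n, s0, l) => //; rewrite /F !lE // Kn eqxx => k /lE -> //.
apply: negligible_bigcup_countType => -[[n s] l] /=.
case: ifPn => [/eqP K0|_]; last exact: negligible_set0.
have mh := measurable_history n.+1 (nth s l).
apply/(negligibleP P mh); rewrite -[LHS]fineK ?fin_num_measure //.
by rewrite history_step K0 mulr0.
Qed.

(** The event is contained in histories of probability at most
    [c * K s s ^+ n] for every [n]. *)
Lemma negligible_stay (l : seq S) (s : S) : 0 <= K s s < 1 ->
  P.-negligible [set w | forall k, X k w = nth s l k].
Proof.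
move=> /andP[K0 K1]; set E := [set w | _].
have EE : E = \bigcap_n history n (nth s l).
  by apply/seteqP; split=> w /= H k; [move=> _ ? _|apply: (H k)].
have mE : measurable E.
  by rewrite EE; apply: bigcapT_measurable => n; exact: measurable_history.
apply/(negligibleP P mE); rewrite -[LHS]fineK ?fin_num_measure //; congr EFin.
apply/eqP; rewrite eq_le fine_ge0 // andbT.
pose c := fine (P (history (size l) (nth s l))).
have cK : (fun n => c * K s s ^+ n) @ \oo --> (0 : R).
  rewrite -[X in _ --> X](mulr0 c); apply: cvgMr; apply: cvg_expr.
  by rewrite ger0_norm.
rewrite -(cvg_lim _ cK) //; apply: limr_ge; first by apply/cvg_ex; exists 0.
apply: nearW => n; rewrite -history_stay; apply: fine_le.
- exact: fin_num_measure.
- by apply: fin_num_measure => //; exact: measurable_history.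
apply: le_measure; rewrite ?inE //; first exact: measurable_history.
by rewrite EE; exact: bigcap_inf.
Qed.

(** A chain that can only hold or lower its rank, and cannot hold forever away
    from [a], must meet [a]. *)
Lemma ranked_chain_hits (r : S -> nat) (a : S) :
  (forall x y, K x y != 0 -> y = x \/ (r y < r x)%N) ->
  (forall x, x != a -> 0 <= K x x < 1) ->
  P [set w | exists n, X n w = a] = 1%E.
Proof.
move=> Kr Kdiag; set H := [set w | _].
have mH : measurable H.
  rewrite (_ : H = \bigcup_n [set w | X n w = a]).
    by apply: bigcupT_measurable => n; exact: measurable_state.
  by apply/seteqP; split=> w /= [n]; [exists n|exists n].
pose F (i : S * seq S) := if i.1 == a then set0
  else [set w | forall k, X k w = nth i.1 i.2 k].
suff negH : P.-negligible (~` H).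
  have mC : measurable (~` H) by exact: measurableC.
  by rewrite -[H]setCK probability_setC // (negligibleP P mC).1 // sube0.
apply: negligibleS (negligibleU negligible_zero_transition
  (@negligible_bigcup_countType _ _ _ P _ F _)); last first.
  case=> s l; rewrite /F /=; case: eqVneq => [_|sa]; first exact: negligible_set0.
  by apply: negligible_stay; exact: Kdiag.
move=> w nHw; have [Zw|nZw] := pselect (exists n, K (X n w) (X n.+1 w) = 0).
  by left.
right; have [n stat] : exists n, forall k, (n <= k)%N -> X k w = X n w.
  apply: (@stationary_of_rank _ r (X^~ w)) => n; apply: Kr.
  by apply/eqP => K0; apply: nZw; exists n.
(* The path agrees with its first [n] states followed by its final value. *)
exists (X n w, mkseq (X^~ w) n) => //; rewrite /F /=.
case: eqVneq => [Xa|_]; first by case: nHw; exists n.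
move=> k; have [nk|kn] := leqP n k; last by rewrite nth_mkseq.
by rewrite nth_default ?size_mkseq ?stat.
Qed.

End MarkovPaths.

(** * Nonvanishing of the normalization V *)

(** Writing x = z p^i <= z, the inequality 1 + y <= exp y at y = x / (1 - x) gives
    1 - x >= exp (- x / (1 - x)) >= exp (- z p^i / (1 - z)).  The geometric series
    then bounds all partial products below by the same positive number, and they
    decrease. *)
Lemma qpoch_inf_gt0 (R : realType) (z p : R) : 0 < z < 1 -> 0 < p < 1 -> 0 < qpoch_inf z p.
Proof.
move=> /andP[z0 z1] /andP[p0 p1].
have zp i : 0 < z * p ^+ i <= z.
  by rewrite mulr_gt0 ?exprn_gt0 //= ler_piMr ?(ltW z0) // exprn_ile1 // ltW.
pose b := expR (- (z / (1 - z) / (1 - p))).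
pose u n := \prod_(0 <= i < n) (1 - z * p ^+ i).
have factor i : expR (- (z / (1 - z) * p ^+ i)) <= 1 - z * p ^+ i.
  have /andP[x0 xz] := zp i; set x := z * p ^+ i in x0 xz *.
  have x1 : 0 < 1 - x by rewrite subr_gt0 (le_lt_trans xz).
  apply: (@le_trans _ _ (expR (- (x / (1 - x))))).
    rewrite ler_expR lerN2 [leRHS]mulrAC -/x; apply: ler_wpM2l; first exact: ltW.
    by rewrite lef_pV2 ?posrE // ?subr_gt0 // lerB.
  rewrite expRN -[leRHS]invrK lef_pV2 ?posrE ?expR_gt0 ?invr_gt0 //.
  apply: le_trans (expR_ge1Dx _).
  by rewrite -[leLHS]mul1r ler_pdivrMr // mulrDl mul1r divfK ?gt_eqF // subrK.
have ub n : b <= u n.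
  apply: (@le_trans _ _ (\prod_(0 <= i < n) expR (- (z / (1 - z) * p ^+ i)))).
    rewrite -expR_sum ler_expR sumrN lerN2 -mulr_sumr.
    apply: ler_wpM2l; first by rewrite divr_ge0 ?subr_ge0 // ltW.
    have q1 : 0 < 1 - p by rewrite subr_gt0.
    rewrite -[leRHS]mul1r ler_pdivlMr // mulrC big_mkord -opprB mulNr -subrX1.
    by rewrite opprB gerBl exprn_ge0 // ltW.
  by apply: ler_prod => i _; rewrite expR_ge0 factor.
have b0 : 0 < b by exact: expR_gt0.
apply: (lt_le_trans b0); apply: limr_ge; last exact: nearW.
apply: (@nonincreasing_is_cvgn _ u); last by exists b => _ [n _ <-].
apply/nonincreasing_seqP => n; rewrite /u big_nat_recr //=.
have /andP[x0 _] := zp n.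
by rewrite ler_piMr ?gerBl ?ltW // (lt_le_trans b0 (ub n)).
Qed.

Lemma weyl_ge0 m (x : weyl m) i : 0 <= x i.
Proof. by case: x => x /= /andP[/forallP]. Qed.

(** Integer coordinates that decrease strictly drop by at least 1 per index. *)
Lemma weyl_gap m (x : weyl m) (i j : 'I_m) : (i <= j)%N ->
  j%:Z - i%:Z <= x i - x j.
Proof.
have xlt (k l : 'I_m) : (k < l)%N -> x l < x k.
  by case: x => x /= /andP[_ /forallP/(_ k)/forallP/(_ l)/implyP].
case: j => n nm /=; elim: n nm => [|n IH] nm.
  by rewrite leqn0 => /eqP i0; rewrite (_ : i = Ordinal nm) ?subrr //; exact: val_inj.
rewrite leq_eqVlt => /orP[/eqP ij|ij].
  by rewrite (_ : i = Ordinal nm) ?subrr //; exact: val_inj.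
have := IH (ltnW nm) ij; have := xlt (Ordinal (ltnW nm)) (Ordinal nm) (ltnSn n).
by lia.
Qed.

Lemma weyl_ge_delta m (x : weyl m) (i : 'I_m) : (m - i.+1)%:Z <= x i.
Proof.
have m0 : (m.-1 < m)%N by rewrite (ltn_predK (ltn_ord i)).
have im : (i <= Ordinal m0)%N by rewrite -ltnS (ltn_predK (ltn_ord i)).
by have := weyl_gap x im; have := weyl_ge0 x (Ordinal m0); have /= := ltn_ord i; lia.
Qed.

(** By [weyl_gap] the exponent of [t] in every Pochhammer argument is at least 1,
    so these arguments stay below 1. *)
Lemma Vtq_neq0 (R : realType) (q t : R) m (x : weyl m) :
  0 < q < 1 -> 0 < t < 1 -> Vtq q t x != 0.
Proof.
move=> /andP[q0 q1] /andP[t0 t1]; apply/prodf_neq0 => i _.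
apply/prodf_neq0 => j ij.
have pos k : 0 < qpoch_inf (q ^+ k * t ^ (x i - x j - j%:Z + i%:Z + 1)) t.
  have := weyl_gap x (ltnW ij).
  case: (x i - x j - j%:Z + i%:Z) (addrK i%:Z (x i - x j - j%:Z)) => [n|n]; last by lia.
  move=> _ _; rewrite -PoszD addn1 -exprnP; apply: qpoch_inf_gt0; last by rewrite t0.
  rewrite mulr_gt0 ?exprn_gt0 //= (@le_lt_trans _ _ (t ^+ n.+1)) //.
    by rewrite ler_piMl ?exprn_ge0 ?exprn_ile1 // ltW.
  by rewrite exprn_ilt1 // ltW.
by rewrite mulf_neq0 ?invr_eq0 ?gt_eqF ?pos.
Qed.

(** * The holding probabilities and the rank *)

(** By [weyl_ge_delta] the terms inside the absolute values are nonnegative, so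
    this is the coordinate sum of [x] minus that of [delta m]. *)
Definition excess m (x : weyl m) : nat :=
  (\sum_(i < m) `|x i - (m - i.+1)%:Z|)%N.

Lemma excess_delta m (x : weyl m) : (excess x == 0%N) = (x == delta m).
Proof.
apply/idP/eqP => [|->]; last first.
  by rewrite sum_nat_eq0; apply/forallP => i; rewrite /= ffunE subrr.
rewrite sum_nat_eq0 => /forallP x0; apply/val_inj/ffunP => i.
by have := x0 i; rewrite /= ffunE absz_eq0 subr_eq0 => /eqP.
Qed.

(** The prefactor [t ^- 'C(m, 2)] removes exactly the coordinate sum
    0 + 1 + ... + (m - 1) of [delta m]. *)
Lemma Upsilon_diag (R : realType) (q t : R) m (x : weyl m) :
  0 < q < 1 -> 0 < t < 1 -> Upsilon q t x x = t ^+ excess x.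
Proof.
move=> q01 t01; have /andP[t0 _] := t01.
have xx (i : 'I_m) : (x i == x i - 1) = false by apply/negbTE; lia.
rewrite /Upsilon; case: forallP => [_|[]]; last by move=> i; rewrite eqxx.
rewrite divff ?Vtq_neq0 // mulr1.
rewrite [X in _ * X * _ * _]big1 => [|i _]; last first.
  by rewrite big_pred0 // => j; rewrite xx !andbF.
rewrite mulr1 [X in _ * _ * X]big_pred0 => [|i]; last exact: xx.
rewrite mulr1 (eq_bigl xpredT) => [|i]; last by rewrite eqxx.
have split_t (i : 'I_m) : t ^ x i
    = t ^+ (m - i.+1) * t ^+ `|x i - (m - i.+1)%:Z|.
  rewrite -exprD exprnP; congr (_ ^ _); have := weyl_ge_delta x i; lia.
rewrite (eq_bigr _ (fun i _ => split_t i)) big_split /= !prodrXr.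
rewrite (_ : (\sum_(i < m) (m - i.+1))%N = 'C(m, 2)).
  by rewrite mulrA mulVf ?mul1r ?expf_neq0 ?gt_eqF.
by rewrite -bin2_sum big_mkord (reindex_inj rev_ord_inj); apply: eq_bigr => i _ /=;
  have := ltn_ord i; lia.
Qed.

(** Both [x] and [y] dominate [delta m], so lowering a coordinate lowers its
    distance to [delta m]. *)
Lemma Upsilon_decreases (R : realType) (q t : R) m (x y : weyl m) :
  Upsilon q t x y != 0 -> y = x \/ (excess y < excess x)%N.
Proof.
rewrite /Upsilon; case: forallP => [xy _|_]; last by rewrite eqxx.
have [->|neq] := eqVneq y x; [by left|right].
have le (i : 'I_m) : (`|y i - (m - i.+1)%:Z| <= `|x i - (m - i.+1)%:Z|)%N.
  by have := xy i; have := weyl_ge_delta y i; have := weyl_ge_delta x i; lia.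
rewrite ltn_neqAle leq_sum ?andbT //; apply: contra neq.
rewrite (leqif_sum (fun i _ => leqif_eq (le i))).2 => /forallP eq_i.
apply/eqP/val_inj/ffunP => i; have := eq_i i.
by have := weyl_ge_delta y i; have := weyl_ge_delta x i; rewrite /=; lia.
Qed.

Theorem proposition3p3 (R : realType) (q t : R) (hq : 0 < q < 1) (ht : 0 < t < 1)
    (m : nat) (hm : (1 <= m)%N) :
  (forall (d : measure_display) (Om : measurableType d) (P : probability Om R)
      (x : weyl m) (X : nat -> Om -> weyl m),
     markov_chain P (@Upsilon R q t m) x X ->
     P [set w | exists n : nat, X n w = delta m] = 1%E)
  /\ absorbing (@Upsilon R q t m) (delta m).
Proof.
have /andP[t0 t1] := ht; split; last first.
  have /eqP e0 : excess (delta m) == 0%N by rewrite excess_delta.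
  by rewrite /absorbing Upsilon_diag // e0.
move=> d Om P x X chainX.
apply: (ranked_chain_hits chainX (r := @excess m)) => [y z|y neq].
  exact: Upsilon_decreases.
by rewrite Upsilon_diag // exprn_ge0 ?ltW //= exprn_ilt1 ?ltW // excess_delta.
Qed.
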